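(* Let $\mathbf{A}\in\mathbb{R}^{d\times d}$ be symmetric positive definite with spectrum (set of eigenvalues) $\Lambda$, and let $\mathbf{b}\in\mathbb{R}^d$. Then for every integer $k\ge2$, the Lanczos-FA iterate satisfies $$\|\mathbf{A}^{1/2}\mathbf{b}-\mathsf{lan}_k(x^{1/2};\mathbf{A},\mathbf{b})\|_2\le\frac{3\kappa(\mathbf{A})^2}{k^{3/2}}\,\|\mathbf{b}\|_2\min_{\deg(p)<k/2+1}\left(\max_{x\in\Lambda\cup\{0\}}\left|\sqrt{x}-p(x)\right|\right),$$ where the minimum is over real polynomials $p$ of degree less than $k/2+1$.
   Context: For a symmetric matrix $\mathbf{M}=\sum_i\mu_i\mathbf{u}_i\mathbf{u}_i^{\mathsf T}$ (orthonormal eigendecomposition) and a scalar function $f$ defined on its eigenvalues, $f(\mathbf{M}):=\sum_i f(\mu_i)\mathbf{u}_i\mathbf{u}_i^{\mathsf T}$. The Krylov subspace is $\mathcal{K}_k(\mathbf{A},\mathbf{b})=\operatorname{span}\{\mathbf{b},\mathbf{A}\mathbf{b},\dots,\mathbf{A}^{k-1}\mathbf{b}\}$. Let $\mathbf{Q}$ be the matrix whose columns are the orthonormal basis of $\mathcal{K}_k(\mathbf{A},\mathbf{b})$ produced by the Lanczos algorithm in exact arithmetic (Gram–Schmidt applied to $\mathbf{b},\mathbf{A}\mathbf{b},\dots$; it has $\dim\mathcal{K}_k(\mathbf{A},\mathbf{b})$ columns), and let $\mathbf{T}=\mathbf{Q}^{\mathsf T}\mathbf{A}\mathbf{Q}$,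 which is symmetric tridiagonal. The Lanczos-FA iterate is $\mathsf{lan}_k(f;\mathbf{A},\mathbf{b}):=\mathbf{Q}f(\mathbf{T})\mathbf{Q}^{\mathsf T}\mathbf{b}$; $\mathsf{lan}_k(x^{1/2};\mathbf{A},\mathbf{b})$ is the case $f(x)=x^{1/2}$. $\kappa(\mathbf{A})$ is the condition number, the ratio of the largest to the smallest eigenvalue of $\mathbf{A}$. *)

(* Defs.v *)
From HB Require Import structures.
From mathcomp Require Import all_boot all_order all_algebra.
From mathcomp Require Import all_classical all_reals all_analysis.

Set Implicit Arguments.
Unset Strict Implicit.
Unset Printing Implicit Defensive.

Import Order.TTheory GRing.Theory Num.Theory.
Local Open Scope classical_set_scope.
Local Open Scope ring_scope.

(* The norm [`|v|] that MathComp-Analysis puts on matrices is the max norm,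
   hence a separate Euclidean norm. *)
Definition norm2 (R : realType) (n : nat) (v : 'cV[R]_n) : R :=
  Num.sqrt (\sum_(i < n) v i 0 ^+ 2).

Definition posdefmx (R : realType) (n : nat) (A : 'M[R]_n) : Prop :=
  A^T = A /\ forall x : 'cV[R]_n, x != 0 -> 0 < (x^T *m A *m x) 0 0.

Definition eigendecomposition (R : realType) (n : nat) (M : 'M[R]_n)
    (mu : 'I_n -> R) (U : 'M[R]_n) : Prop :=
  U^T *m U = 1%:M /\ M = \sum_(i < n) mu i *: (col i U *m (col i U)^T).

(* The value at M does not depend on the eigendecomposition; it is the
   junk value 0 when M is not symmetric. *)
Definition matfun (R : realType) (n : nat) (f : R -> R) (M : 'M[R]_n) :
    'M[R]_n :=
  xget 0 [set N | exists mu U, eigendecomposition M mu U /\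
                    N = \sum_(i < n) f (mu i) *: (col i U *m (col i U)^T)].

Definition spectrum (R : realType) (n : nat) (A : 'M[R]_n) : set R :=
  [set x | eigenvalue A x].

(* The spectrum is finite, and nonempty for A symmetric with n > 0, so that
   sup and inf are the largest and smallest eigenvalues. *)
Definition cond (R : realType) (n : nat) (A : 'M[R]_n) : R :=
  sup (spectrum A) / inf (spectrum A).

(* A vector that depends linearly on its predecessors is dropped. *)
Definition gram_schmidt_step (R : realType) (d : nat) (qs : seq 'cV[R]_d)
    (v : 'cV[R]_d) : seq 'cV[R]_d :=
  let w := v - \sum_(q <- qs) (q^T *m v) 0 0 *: q in
  if w == 0 then qs else rcons qs ((norm2 w)^-1 *: w).

Definition gram_schmidt (R : realType) (d : nat) (vs : seq 'cV[R]_d) :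
    seq 'cV[R]_d :=
  foldl (@gram_schmidt_step R d) [::] vs.

Definition krylov_seq (R : realType) (d : nat) (A : 'M[R]_d) (b : 'cV[R]_d)
    (k : nat) : seq 'cV[R]_d :=
  [seq A ^+ i *m b | i <- iota 0 k].

Definition lanczos_basis (R : realType) (d : nat) (A : 'M[R]_d)
    (b : 'cV[R]_d) (k : nat) : seq 'cV[R]_d :=
  gram_schmidt (krylov_seq A b k).

Definition lanczosQ (R : realType) (d : nat) (A : 'M[R]_d) (b : 'cV[R]_d)
    (k : nat) : 'M[R]_(d, size (lanczos_basis A b k)) :=
  \matrix_(i, j) (lanczos_basis A b k)`_j i 0.

Definition lanczosT (R : realType) (d : nat) (A : 'M[R]_d) (b : 'cV[R]_d)
    (k : nat) : 'M[R]_(size (lanczos_basis A b k)) :=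
  (lanczosQ A b k)^T *m A *m lanczosQ A b k.

Definition lan (R : realType) (d k : nat) (f : R -> R) (A : 'M[R]_d)
    (b : 'cV[R]_d) : 'cV[R]_d :=
  lanczosQ A b k *m matfun f (lanczosT A b k) *m (lanczosQ A b k)^T *m b.

(* For S finite and nonempty, the sup is a maximum. *)
Definition approx_error (R : realType) (S : set R) (f : R -> R)
    (p : {poly R}) : R :=
  sup [set `|f x - p.[x]| | x in S].

Definition is_min (R : realType) (S : set R) (m : R) : Prop :=
  S m /\ lbound S m.

(* Main.v *)
Require Import Defs.
From HB Require Import structures.
From mathcomp Require Import all_boot all_order all_algebra.
From mathcomp Require Import all_classical all_reals all_analysis.
From mathcomp Require Import ring lra zify.
From mathcomp Require Import complex.

Set Implicit Arguments.
Unset Strict Implicit.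
Unset Printing Implicit Defensive.

Import Order.TTheory GRing.Theory Num.Theory.
Import numFieldNormedType.Exports.
Local Open Scope classical_set_scope.
Local Open Scope ring_scope.

(** Why the bound holds.

    In an eigenbasis of [A] the problem is scalar.  Let [p] interpolate the
    square root at the distinct eigenvalues [theta] of [T], and let
    [F = prod (X - theta)].  Since [q(A) b = Q q(T) Q^T b] for every [q] of
    degree less than [k], the Lanczos iterate is [p(A) b], so the coordinates
    of the error are those of [b] multiplied by [sqrt mu - p(mu)], with [mu]
    running over the spectrum.  Three estimates then combine; [L] and [l] are
    the extreme eigenvalues.

    - Interpolation ([sqrt_interpolation_error]).  The substitution
      [u = 1/x] turns the interpolation of [sqrt x] by [p] into that of
      [u^(k - 3/2)] by the reversed polynomial.  The [k]-th derivative of this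
      power is a multiple of [u^(-3/2)], which decreases in [u], so Rolle's
      theorem gives
      [|sqrt x - p(x)| <= c_k L^(3/2) |F(x) / (x F(0))|] with
      [c_k = |binom(1/2, k)|].  Applying Rolle directly in [x] would bring in
      high negative powers of [l].  The numbers [c_k k^(3/2)] decrease from
      [k = 2] on, where their value is below [3/8] ([sqrt_coef_le]).

    - Optimality ([residual_minimal]).  When [T] has [k] distinct eigenvalues,
      [F(A) b] is orthogonal to the Krylov space, by the same identity one
      degree further.  Hence [F / F(0)] minimises the sum of
      [P(mu)^2 / mu], weighted by the squared coordinates of [b], among the
      polynomials [P] of degree at most [k] with [P(0) = 1]: this is the
      optimality of conjugate gradients.  When [T] has fewer eigenvalues,
      [F(A) b = 0] and the error vanishes.

    - A competitor ([residual_of_sqrt_approx]).  If [q] is within [e] of the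
      square root on the spectrum and at [0], write [q = q(0) + X s].  Then
      [P = 1 - X s^2] has degree at most [k] because [deg q < k/2 + 1], and
      [x P(x) = (sqrt x - x s(x)) (sqrt x + x s(x))] is at most
      [2 e * 4 sqrt L] when [e <= sqrt L]; for a larger [e] the choice
      [P = 1] is enough.

    Together they bound the error by [8 c_k (L / l)^2 e |b|].

    Two existence results complete the proof: symmetric real matrices have
    orthonormal eigendecompositions ([spectral_theorem]), which is what makes
    [matfun] meaningful, and a best polynomial approximation on a finite set
    exists ([best_approximation_exists]). *)

(** * Interpolation of powers by polynomials *)

Lemma interpolation_exists (F : fieldType) (f : F -> F) (s : seq F) :
  uniq s -> exists2 p : {poly F}, (size p <= size s)%N &
    {in s, forall x, p.[x] = f x}.
Proof.
elim: s => [|y s IHs] /=; first by exists 0; rewrite ?size_poly0.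
move=> /andP[ys /IHs[p szp pE]]; pose W := \prod_(x <- s) ('X - x%:P).
have WE z : W.[z] = \prod_(x <- s) (z - x).
  by rewrite horner_prod; apply: eq_bigr => u _; rewrite !hornerE.
have W0 : W.[y] != 0.
  rewrite WE prodf_seq_neq0; apply/allP => x xs /=.
  by rewrite subr_eq0; apply: contraNneq ys => ->.
exists (p + ((f y - p.[y]) / W.[y]) *: W).
  rewrite (leq_trans (size_polyD _ _))// geq_max (leq_trans szp)//=.
  by rewrite (leq_trans (size_scale_leq _ _))// size_prod_XsubC.
move=> x; rewrite inE hornerD hornerZ => /predU1P[->|xs].
  by rewrite divfK// addrC subrK.
rewrite pE// [W.[x]]WE (_ : \prod_(_ <- s) _ = 0) ?mulr0 ?addr0//.
by apply/eqP; rewrite prodf_seq_eq0; apply/hasP; exists x => //=; rewrite subrr.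
Qed.

Lemma monic_derivn_size (R : comNzRingType) (n : nat) (p : {poly R}) (x : R) :
  p \is monic -> size p = n.+1 -> p^`(n).[x] = n`!%:R.
Proof.
move=> /monicP; rewrite /lead_coef => lp szp; rewrite szp/= in lp.
have : (size p^`(n) <= 1)%N.
  by apply/leq_sizeP => j j1; rewrite coef_derivn nth_default ?mul0rn//
     szp -addn1 leq_add2l.
move=> /size1_polyC ->; by rewrite hornerC coef_derivn addn0 lp ffactnn.
Qed.

(** The zeros of [f] are kept as a strictly increasing sequence, so that one
    application of Rolle between consecutive entries again yields one. *)
Lemma Rolle_zeros (R : realType) (f df : R -> R) (l x : R) (s : seq R) :
  (forall u, l <= u -> is_derive u 1 f (df u)) -> l <= x ->
  path <%R x s -> all (fun u => f u == 0) (x :: s) ->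
  exists t, [/\ size t = size s, path <%R x t & all (fun u => df u == 0) t].
Proof.
move=> fD; elim: s x => [|y s IHs] x lx; first by exists [::].
move=> /= /andP[xy pys] /andP[/eqP fx0 fys].
have ly : l <= y by rewrite (le_trans lx) ?ltW.
have [t [szt pyt dft]] := IHs y ly pys fys.
have /andP[/eqP fy0 _] := fys.
have [|||c] := @Rolle R f x y xy; last 1 first.
- rewrite in_itv/= => /andP[xc cy] dc; exists (c :: t); split => /=.
  + by rewrite szt.
  + rewrite xc /=; case: (t) pyt => //= z r /andP[yz ->].
    by rewrite (lt_trans cy yz).
  + rewrite dft andbT; have lc : l <= c by rewrite (le_trans lx) ?ltW.
    have [_ <-] := fD c lc.
    by have [_ ->] := dc.
- move=> c; rewrite in_itv/= => /andP[xc _].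
  by have [] := fD c (le_trans lx (ltW xc)).
- apply: derivable_within_continuous => u; rewrite in_itv/= => /andP[xu _].
  by have [] := fD u (le_trans lx xu).
- by rewrite fx0 fy0.
Qed.

(** The family [c u^a + P] is stable under differentiation, so iterating Rolle
    needs no notion of higher derivative of a function. *)
Lemma powR_poly_Rolle (R : realType) (n : nat) (c a : R) (P : {poly R})
    (x : R) (s : seq R) :
  0 < x -> size s = n -> path <%R x s ->
  all (fun u => c * u `^ a + P.[u] == 0) (x :: s) ->
  exists2 xi, x <= xi &
    c * \prod_(i < n) (a - i%:R) * xi `^ (a - n%:R) + P^`(n).[xi] = 0.
Proof.
elim: n c a P x s => [|n IHn] c a P x s x0 szs pxs zs.
  exists x => //; rewrite big_ord0 mulr1 subr0 derivn0.
  by move: zs => /andP[/eqP].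
have fD u : x <= u ->
    is_derive u 1 (fun u => c * u `^ a + P.[u])
      (c * a * u `^ (a - 1) + P^`().[u]).
  move=> xu; have u0 : 0 < u by exact: lt_le_trans xu.
  have dp := is_derive1_powR a u0.
  have := is_deriveD (is_deriveZ c dp) (is_derive_poly P u).
  by move=> h; apply: is_derive_eq h _; rewrite /GRing.scale/= mulrA.
have [t [szt pxt zt]] := Rolle_zeros fD (lexx x) pxs zs.
move: szt; rewrite szs; case: t pxt zt => //= y t /andP[xy pyt] zt [szt].
have [xi yxi E] := IHn (c * a) (a - 1) P^`() y t (lt_trans x0 xy) szt pyt zt.
exists xi; first by rewrite (le_trans (ltW xy)).
rewrite big_ord_recl subr0 -derivnS derivSn -[RHS]E; congr (_ + _).
rewrite !mulrA; congr (_ * _ * _ `^ _).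
  by apply: eq_bigr => i _; rewrite /= /bump/= natrD opprD addrA.
by rewrite -natr1 opprD addrA addrAC.
Qed.

(** The classical remainder formula: subtract from [u^a - P] the multiple of the
    nodal polynomial that makes [v] one more zero, and apply Rolle as many
    times as there are nodes. *)
Lemma powR_interpolation_error (R : realType) (a l v : R) (us : seq R)
    (P : {poly R}) :
  0 < l -> uniq us -> all (>= l) us -> l <= v -> (size P <= size us)%N ->
  {in us, forall u, P.[u] = u `^ a} ->
  exists2 xi, l <= xi &
    v `^ a - P.[v] = (\prod_(i < size us) (a - i%:R)) / (size us)`!%:R
      * xi `^ (a - (size us)%:R) * \prod_(u <- us) (v - u).
Proof.
move=> l0 us_uniq lus lv szP PE.
have [vus|vNus] := boolP (v \in us).
  exists l => //; rewrite PE// subrr.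
  suff -> : \prod_(u <- us) (v - u) = 0 by rewrite mulr0.
  by apply/eqP; rewrite prodf_seq_eq0; apply/hasP; exists v => //=; rewrite subrr.
set n := size us; pose W := \prod_(u <- us) ('X - u%:P).
have WE w : W.[w] = \prod_(u <- us) (w - u).
  by rewrite horner_prod; apply: eq_bigr => u _; rewrite !hornerE.
have Wv0 : W.[v] != 0.
  rewrite WE prodf_seq_neq0; apply/allP => u uus /=.
  by rewrite subr_eq0; apply: contraNneq vNus => ->.
(* The constant making [v] a zero of [u^a - P - c W]. *)
pose c := (v `^ a - P.[v]) / W.[v].
have := sort_lt_sorted (v :: us).
rewrite /= vNus us_uniq/=.
have srt := mem_sort <=%R (v :: us).
have szsrt := size_sort <=%R (v :: us).
case E : (sort _ _) srt szsrt => [//|x s] srt [szs] pxs.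
have lx : l <= x.
  have : x \in v :: us by rewrite -srt mem_head.
  by rewrite inE => /predU1P[->//|/(allP lus)].
have [||||xi xxi] := @powR_poly_Rolle R n 1 a (- P - c *: W) x s => //.
- exact: lt_le_trans lx.
- rewrite -/(all (fun u => _ == 0) (x :: s)).
  apply/allP => u; rewrite srt inE hornerD !hornerN hornerZ => /predU1P[->|uus].
    by rewrite /c divfK//; apply/eqP; ring.
  rewrite PE// [W.[u]]WE (_ : \prod_(_ <- us) _ = 0) ?mulr0.
    by apply/eqP; ring.
  by apply/eqP; rewrite prodf_seq_eq0; apply/hasP; exists u => //=; rewrite subrr.
rewrite derivnB derivnN derivn_poly0// derivnZ.
rewrite hornerD !hornerN hornerZ horner0 monic_derivn_size//.
- move=> /eqP; rewrite mul1r oppr0 add0r subr_eq0 => /eqP xiE; exists xi.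
    exact: le_trans xxi.
  rewrite -WE [_ / _ * _]mulrAC xiE mulfK ?pnatr_eq0 -?lt0n ?fact_gt0//.
  by rewrite /c divfK.
- exact: monic_prod_XsubC.
- by rewrite size_prod_XsubC.
Qed.

(** * The square root in the variable 1/x *)

(** This is [|binom(1/2, k)|], with the factors of the numerator taken in
    absolute value. *)
Definition sqrt_coef (R : realType) (k : nat) : R :=
  \prod_(i < k) `|i%:R - 2^-1| / k`!%:R.

Lemma sqrt_coef_ge0 (R : realType) (k : nat) : 0 <= sqrt_coef R k.
Proof. by rewrite /sqrt_coef mulr_ge0// prodr_ge0. Qed.

Lemma sqrt_coefS (R : realType) (k : nat) :
  sqrt_coef R k.+1 = sqrt_coef R k * (`|k%:R - 2^-1| / k.+1%:R).
Proof.
rewrite /sqrt_coef big_ord_recr/= factS natrM invfM.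
by rewrite [k.+1%:R^-1 * _]mulrC mulrACA.
Qed.

(** The square of [sqrt_coef R k * k^(3/2)] decreases, because
    [(k - 1/2)^2 (k + 1) <= k^3] for [1 <= k]; at [k = 2] it equals [1/8]. *)
Lemma sqrt_coef_le (R : realType) (k : nat) :
  (2 <= k)%N -> sqrt_coef R k ^+ 2 * k%:R ^+ 3 <= (3 / 8) ^+ 2.
Proof.
elim: k => // k IHk; rewrite ltnS leq_eqVlt => /predU1P[<-|k2].
  rewrite !sqrt_coefS /sqrt_coef big_ord0 fact0 sub0r normrN.
  rewrite !ger0_norm ?subr_ge0 ?invr_ge0 ?invf_le1//.
    by rewrite mul1r invr1 !mul1r; lra.
  by rewrite ler1n.
apply: le_trans (IHk k2); rewrite sqrt_coefS exprMn -mulrA.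
rewrite ler_wpM2l ?sqr_ge0// expr_div_n real_normK ?num_real//.
have k0 : 0 < k.+1%:R :> R by rewrite ltr0n.
rewrite [k.+1%:R ^+ 3]exprSr mulrA divfK ?expf_neq0 ?gt_eqF//.
have : 2 <= k%:R :> R by rewrite ler_nat.
rewrite -(natr1 k) -subr_ge0; move: (k%:R) => x x2.
rewrite [leRHS](_ : _ = 3 / 4 * x - 4^-1); first by lra.
by field.
Qed.

Lemma powR_inv (R : realType) (a r : R) : 0 <= a -> a^-1 `^ r = (a `^ r)^-1.
Proof. by move=> a0; rewrite -powR_inv1// -powRrM mulN1r powRN. Qed.

Lemma powR_shift (R : realType) (k : nat) (u : R) : 0 < u ->
  u `^ (k.+1%:R - 3 / 2) = u ^+ k * Num.sqrt u^-1.
Proof.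
move=> u0; rewrite -powR_mulrn ?ltW// -powR12_sqrt ?invr_ge0 ?ltW//.
rewrite powR_inv ?ltW// -powRN.
rewrite -powRD; last by rewrite (gt_eqF u0) implybT.
by congr (_ `^ _); rewrite -(natr1 k); lra.
Qed.

Lemma horner_rev (R : realType) (k : nat) (p : {poly R}) (u : R) : u != 0 ->
  (size p <= k.+1)%N ->
  (\poly_(i < k.+1) p`_(k - i)).[u] = u ^+ k * p.[u^-1].
Proof.
move=> u0 szp; rewrite horner_poly (horner_coef_wide _ szp) mulr_sumr.
rewrite (reindex_inj rev_ord_inj)/=; apply: eq_bigr => i _.
have ik : (i <= k)%N by rewrite -ltnS.
rewrite subSS subKn// mulrCA; congr (_ * _).
by rewrite exprVn; apply: (canRL (mulfK _)); rewrite ?expf_neq0// -exprD subnK.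
Qed.

(** In the variable [u = 1/x] the interpolated function is [u^(k - 3/2)], whose
    [k]-th derivative [k! c_k u^(-3/2)] is controlled by the smallest admissible
    [u], namely [1 / L], so no lower bound on the nodes enters. *)
Lemma sqrt_interpolation_error (R : realType) (L x : R) (ths : seq R)
    (p : {poly R}) :
  uniq ths -> {in ths, forall th, 0 < th <= L} -> 0 < x <= L ->
  (0 < size ths)%N -> (size p <= size ths)%N ->
  {in ths, forall th, p.[th] = Num.sqrt th} ->
  `|Num.sqrt x - p.[x]| <=
    sqrt_coef R (size ths) * (L * Num.sqrt L) *
      (x^-1 * \prod_(th <- ths) `|(x - th) / th|).
Proof.
move=> ths_uniq thsL /andP[x0 xL].
case sz : (size ths) => [//|k] _ szp pE.
have L0 : 0 < L by exact: lt_le_trans xL.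
pose us := [seq th^-1 | th <- ths].
have szus : size us = k.+1 by rewrite size_map.
pose P := \poly_(i < k.+1) p`_(k - i).
have [||||||xi Lxi] := @powR_interpolation_error R (k.+1%:R - 3 / 2) L^-1 x^-1 us P.
- by rewrite invr_gt0.
- by rewrite map_inj_uniq//; exact: invr_inj.
- apply/allP => _ /mapP[th /thsL/andP[th0 thL] ->] /=.
  by rewrite lef_pV2.
- by rewrite lef_pV2.
- by rewrite szus size_poly.
- move=> _ /mapP[th thin ->]; have /andP[th0 _] := thsL _ thin.
  by rewrite horner_rev ?invr_eq0 ?gt_eqF// powR_shift ?invr_gt0// invrK pE.
rewrite powR_shift ?invr_gt0// horner_rev ?invr_eq0 ?gt_eqF// invrK -mulrBr szus.
move=> /(congr1 (fun z => x ^+ k * `|z|)) /=.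
have xk0 : 0 <= x^-1 ^+ k by rewrite exprn_ge0// invr_ge0 ltW.
rewrite normrM (ger0_norm xk0) [x^-1 ^+ k]exprVn mulVKf ?expf_neq0 ?gt_eqF//.
move=> ->; rewrite !normrM -!mulrA mulrCA.
have -> : `|\prod_(i < k.+1) (k.+1%:R - 3 / 2 - i%:R)| =
    \prod_(i < k.+1) `|i%:R - 2^-1 :> R|.
  rewrite normr_prod (reindex_inj rev_ord_inj)/=; apply: eq_bigr => i _.
  have ik : (i <= k)%N by rewrite -ltnS.
  congr `| _ |; rewrite subSS natrB// -(natr1 k); lra.
rewrite ler_wpM2l ?prodr_ge0//.
rewrite [leLHS]mulrCA normfV normr_nat ler_wpM2l//.
have -> : `|\prod_(u <- us) (x^-1 - u)| =
    x ^- k.+1 * \prod_(th <- ths) `|(x - th) / th|.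
  rewrite normr_prod big_map -[k.+1]sz.
  elim: (ths) (thsL) => [|th s IHs] sL; first by rewrite !big_nil expr0 invr1 mulr1.
  rewrite !big_cons {}IHs; last by move=> y ys; rewrite sL// inE ys orbT.
  have /andP[th0 _] := sL th (mem_head _ _).
  rewrite exprS invfM mulrACA; congr (_ * _).
  rewrite -[X in _ = X * _](ger0_norm (ltW _)) ?invr_gt0// -normrM distrC.
  by congr `| _ |; field; rewrite !gt_eqF.
have -> : (x ^+ k * (`|xi `^ (k.+1%:R - 3 / 2 - k.+1%:R)| *
   (x ^- k.+1 * \prod_(th <- ths) `|(x - th) / th|))) =
   `|xi `^ (k.+1%:R - 3 / 2 - k.+1%:R)| * (x^-1 * \prod_(th <- ths) `|(x - th) / th|).
  rewrite mulrCA; congr (_ * _); rewrite mulrA; congr (_ * _).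
  by rewrite exprS invfM mulrCA mulfV ?mulr1// expf_neq0// gt_eqF.
rewrite [L * (_ * _)]mulrA; apply: ler_wpM2r.
  by apply: mulr_ge0; [rewrite invr_ge0 ltW|exact: prodr_ge0].
have xi0 : 0 < xi by rewrite (lt_le_trans _ Lxi)// invr_gt0.
rewrite ger0_norm ?powR_ge0// addrAC subrr add0r powRN.
have -> : L * Num.sqrt L = (L^-1 `^ (3 / 2))^-1.
  rewrite powR_inv ?ltW// invrK -powR12_sqrt ?ltW// -[X in X * _]powRr1 ?ltW//.
  rewrite -powRD; last by rewrite (gt_eqF L0) implybT.
  by congr (_ `^ _); lra.
rewrite lef_pV2 ?posrE ?powR_gt0 ?invr_gt0//.
by rewrite ge0_ler_powR// ?nnegrE ?invr_ge0 ?ltW//; lra.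
Qed.

(** * The scalar estimate *)

(** Pythagoras: [P - Q] is [X t] with [t] of size at most [k], hence
    orthogonal to [Q] for the weights [w / mu]. *)
Lemma residual_minimal (R : realType) (n k : nat) (mu w : 'I_n -> R)
    (Q P : {poly R}) :
  (forall i, 0 < mu i) -> (forall i, 0 <= w i) ->
  (size Q <= k.+1)%N -> (size P <= k.+1)%N -> Q.[0] = P.[0] ->
  (forall s : {poly R}, (size s <= k)%N -> \sum_i w i * (Q.[mu i] * s.[mu i]) = 0) ->
  \sum_i w i * (Q.[mu i] ^+ 2 / mu i) <= \sum_i w i * (P.[mu i] ^+ 2 / mu i).
Proof.
move=> mu0 w0 szQ szP PQ0 orth.
have /factor_theorem[t tE] : root (P - Q) 0.
  by rewrite /root hornerD hornerN PQ0 subrr.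
rewrite subr0 in tE.
have szt : (size t <= k)%N.
  have [->|t0] := eqVneq t 0; first by rewrite size_poly0.
  rewrite -ltnS -size_mulX// -tE (leq_trans (size_polyD _ _))//.
  by rewrite size_polyN geq_max szP.
have PE x : P.[x] = Q.[x] + t.[x] * x.
  by rewrite -[P](subrK Q) tE hornerD hornerMX addrC.
rewrite -subr_ge0 -sumrB (eq_bigr (fun i =>
  (w i * (Q.[mu i] * t.[mu i])) *+ 2 + w i * (t.[mu i] ^+ 2 * mu i))).
  rewrite big_split/= sumrMnl orth// mul0rn add0r sumr_ge0// => i _.
  by rewrite mulr_ge0// mulr_ge0 ?sqr_ge0// ltW.
move=> i _; rewrite PE; field; exact: lt0r_neq0.
Qed.

(** The interpolation error is dominated by [Q / X], with [Q = F / F(0)]; one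
    factor [1 / l] pays for passing to the weights [w / mu] in which [Q] is
    minimal, the other for coming back from them. *)
Lemma weighted_sqrt_error (R : realType) (n k : nat) (mu w : 'I_n -> R)
    (l L M : R) (ths : seq R) (p P : {poly R}) :
  0 < l -> (forall i, l <= mu i <= L) -> (forall i, 0 <= w i) ->
  uniq ths -> {in ths, forall th, 0 < th <= L} -> size ths = k ->
  (0 < k)%N -> (size p <= k)%N -> {in ths, forall th, p.[th] = Num.sqrt th} ->
  (forall s : {poly R}, (size s <= k)%N ->
    \sum_i w i * ((\prod_(th <- ths) ('X - th%:P)).[mu i] * s.[mu i]) = 0) ->
  (size P <= k.+1)%N -> P.[0] = 1 -> (forall i, `|P.[mu i]| <= M) ->
  \sum_i w i * (Num.sqrt (mu i) - p.[mu i]) ^+ 2 <=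
    (sqrt_coef R k * (L * Num.sqrt L) / l * M) ^+ 2 * \sum_i w i.
Proof.
move=> l0 muB w0 uths thsB szths k0 szp pE orth szP P0 PM.
have mu0 i : 0 < mu i by have /andP[lmu _] := muB i; exact: lt_le_trans lmu.
pose F := \prod_(th <- ths) ('X - th%:P).
have FE x : F.[x] = \prod_(th <- ths) (x - th).
  by rewrite horner_prod; apply: eq_bigr => u _; rewrite !hornerE.
have F00 : F.[0] != 0.
  rewrite FE prodf_seq_neq0; apply/allP => u /thsB/andP[u0 _] /=.
  by rewrite sub0r oppr_eq0 gt_eqF.
pose Q := F.[0]^-1 *: F.
have QE x : `|Q.[x]| = \prod_(th <- ths) `|(x - th) / th|.
  rewrite hornerZ !FE mulrC -prodf_div normr_prod; apply: eq_bigr => th _.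
  by rewrite sub0r invrN mulrN normrN.
set C := sqrt_coef R k * (L * Num.sqrt L).
have C0 (i : 'I_n) : 0 <= C.
  have /andP[_ muL] := muB i.
  have L0 : 0 <= L by rewrite (le_trans _ muL)// ltW.
  by rewrite mulr_ge0 ?sqrt_coef_ge0// mulr_ge0// sqrtr_ge0.
apply: (@le_trans _ _ (\sum_i C ^+ 2 / l * (w i * (Q.[mu i] ^+ 2 / mu i)))).
  apply: ler_sum => i _; rewrite [leRHS]mulrCA ler_wpM2l//.
  have /andP[lmu muL] := muB i.
  have := @sqrt_interpolation_error R L (mu i) ths p uths thsB.
  rewrite szths mu0 -QE => /(_ muL k0 szp pE); rewrite -/C => err.
  apply: (@le_trans _ _ (C ^+ 2 * (Q.[mu i] ^+ 2 / mu i ^+ 2))).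
    rewrite -(real_normK (num_real (_ - _))) -(real_normK (num_real Q.[mu i])).
    rewrite -expr_div_n -exprMn ler_pXn2r ?nnegrE//; last first.
      by apply: mulr_ge0; [exact: C0|apply: divr_ge0 => //; exact: ltW].
    by rewrite [_ / mu i]mulrC.
  rewrite -[leRHS]mulrA ler_wpM2l ?sqr_ge0// [leRHS]mulrCA ler_wpM2l ?sqr_ge0//.
  by rewrite expr2 invfM ler_wpM2r ?lef_pV2 ?posrE// ltW// invr_gt0.
rewrite -mulr_sumr.
have Qmin : \sum_i w i * (Q.[mu i] ^+ 2 / mu i) <=
    \sum_i w i * (P.[mu i] ^+ 2 / mu i).
  apply: (@residual_minimal _ _ k) => //.
  - rewrite size_scale ?invr_eq0// size_prod_XsubC.
    by rewrite szths.
  - by rewrite hornerZ mulVf.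
  - move=> s szs; transitivity (F.[0]^-1 * \sum_i w i * (F.[mu i] * s.[mu i])).
      by rewrite mulr_sumr; apply: eq_bigr => i _;
        rewrite hornerZ -[_ * s.[_]]mulrA mulrCA.
    by rewrite orth// mulr0.
have PB : \sum_i w i * (P.[mu i] ^+ 2 / mu i) <= M ^+ 2 / l * \sum_i w i.
  rewrite mulr_sumr; apply: ler_sum => i _; rewrite [leRHS]mulrC ler_wpM2l//.
  have /andP[lmu muL] := muB i.
  rewrite -(real_normK (num_real P.[mu i])) ler_pM ?sqr_ge0 ?invr_ge0
    ?(ltW (mu0 i))//.
    by rewrite lerXn2r ?nnegrE// (le_trans _ (PM i)).
  by rewrite lef_pV2 ?posrE.
apply: (le_trans (ler_wpM2l _ (le_trans Qmin PB))).
  by rewrite mulr_ge0 ?sqr_ge0// invr_ge0 ltW.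
rewrite mulrA le_eqVlt; apply/orP; left; apply/eqP; congr (_ * _).
by field; exact: lt0r_neq0.
Qed.

(** [1 - X s^2] is small where [x s(x)] is close to [sqrt x], being
    [(sqrt x - x s(x)) (sqrt x + x s(x)) / x]. Removing the value of [q] at [0]
    is what makes [q] divisible by [X], and costs a factor two in the error. *)
Lemma residual_of_sqrt_approx (R : realType) (k : nat) (S : set R)
    (l L e : R) (q : {poly R}) :
  0 < l -> (forall x, S x -> l <= x <= L) ->
  ((size q).-1.*2 <= k.+1)%N -> `|q.[0]| <= e ->
  (forall x, S x -> `|Num.sqrt x - q.[x]| <= e) ->
  exists P : {poly R}, [/\ (size P <= k.+1)%N, P.[0] = 1 &
    forall x, S x -> `|P.[x]| <= 8 * e * Num.sqrt L / l].
Proof.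
move=> l0 SB szq q0 qe.
have e0 : 0 <= e by exact: le_trans q0.
(* For a large [e] the bound exceeds [1], which [P = 1] meets. *)
have [eL|Le] := leP e (Num.sqrt L); last first.
  exists 1; split; [by rewrite size_poly1|by rewrite hornerE|].
  move=> x /SB/andP[lx xL]; rewrite hornerE normr1.
  have L0 : 0 <= L by rewrite (le_trans _ xL)// (le_trans _ lx)// ltW.
  rewrite ler_pdivlMr// mul1r (le_trans (le_trans lx xL))//.
  rewrite -[leLHS]sqr_sqrtr// expr2 ler_wpM2r ?sqrtr_ge0//.
  by have := sqrtr_ge0 L; lra.
have /factor_theorem[s sE] : root (q - q.[0]%:P) 0.
  by rewrite /root !hornerE subrr.
rewrite subr0 in sE.
have szs : (size s <= (size q).-1)%N.
  have [->|s0] := eqVneq s 0; first by rewrite size_poly0.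
  have : (size (s * 'X)%R <= maxn (size q) 1)%N.
    rewrite -sE (leq_trans (size_polyD _ _))// size_polyN geq_max leq_maxl/=.
    by rewrite (leq_trans (size_polyC_leq1 _))// leq_maxr.
  by rewrite size_mulX//; lia.
have qE x : q.[x] = s.[x] * x + q.[0].
  by rewrite -[in LHS](subrK q.[0]%:P q) sE !hornerE.
exists (1 - s * s * 'X); split.
- rewrite (leq_trans (size_polyD _ _))// size_polyN size_poly1 geq_max /=.
  have [->|s0] := eqVneq s 0; first by rewrite !mul0r size_poly0.
  rewrite size_mulX ?mulf_neq0// size_mul//.
  have : (0 < size s)%N by rewrite size_poly_gt0.
  move: szs szq; rewrite -!addnn.
  by move: (size s) (size q).-1 => a c; lia.
- by rewrite hornerD hornerN hornerMX mulr0 subr0 hornerE.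
move=> x Sx; have /andP[lx xL] := SB x Sx.
have x0 : 0 < x by exact: lt_le_trans lx.
have sxL : Num.sqrt x <= Num.sqrt L by rewrite ler_wsqrtr.
have sx0 := sqrtr_ge0 x.
have := qe x Sx; rewrite qE => ex.
(* One [e] from [q], one from the removal of [q.[0]]. *)
have d2 : `|Num.sqrt x - s.[x] * x| <= 2 * e.
  by move: ex q0; rewrite !ler_norml; lra.
have PE : (1 - s * s * 'X).[x] =
    (Num.sqrt x - s.[x] * x) * (Num.sqrt x + s.[x] * x) / x.
  rewrite hornerD hornerN hornerMX hornerM (hornerC 1) -subr_sqr.
  by rewrite sqr_sqrtr ?ltW//; field; exact: lt0r_neq0.
rewrite PE normrM normrM normfV (gtr0_norm x0).
apply: ler_pM; rewrite ?mulr_ge0 ?invr_ge0 ?(ltW x0)//; last by rewrite lef_pV2 ?posrE.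
have d4 : `|Num.sqrt x + s.[x] * x| <= 4 * Num.sqrt L.
  by move: d2; rewrite !ler_norml; lra.
rewrite (_ : 8 * e * _ = (2 * e) * (4 * Num.sqrt L)); last by ring.
by rewrite ler_pM.
Qed.

Lemma sqrt_coef_bound (R : realType) (k : nat) (L l e B : R) : (2 <= k)%N ->
  0 < l -> 0 <= L -> 0 <= e -> 0 <= B ->
  sqrt_coef R k * (L * Num.sqrt L) / l * (8 * e * Num.sqrt L / l) * B <=
  3 * (L / l) ^+ 2 / (k%:R `^ (3 / 2)) * B * e.
Proof.
move=> k2 l0 L0 e0 B0.
have k0 : 0 < k%:R :> R by rewrite ltr0n (leq_trans _ k2).
have K0 : 0 < k%:R `^ (3 / 2) :> R by rewrite powR_gt0.
have gK : sqrt_coef R k * k%:R `^ (3 / 2) <= 3 / 8.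
  have c0 : 0 <= sqrt_coef R k * k%:R `^ (3 / 2).
    by apply: mulr_ge0; [exact: sqrt_coef_ge0|exact: ltW].
  rewrite -(@ler_pXn2r _ 2)//; last by rewrite nnegrE; lra.
  rewrite exprMn -[k%:R `^ _ ^+ 2]powR_mulrn ?(ltW K0)// -powRrM divfK ?pnatr_eq0//.
  by rewrite powR_mulrn ?(ltW k0)// sqrt_coef_le.
rewrite [leLHS](_ : _ = 8 * sqrt_coef R k * ((L / l) ^+ 2 * B * e)).
  rewrite [leRHS](_ : _ = 3 / (k%:R `^ (3 / 2)) * ((L / l) ^+ 2 * B * e)); last by ring.
  rewrite ler_wpM2r ?(mulr_ge0 (mulr_ge0 (sqr_ge0 _) B0) e0)//.
  by rewrite ler_pdivlMr//; lra.
transitivity (8 * sqrt_coef R k * L * Num.sqrt L ^+ 2 / l ^+ 2 * B * e).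
  by field; exact: lt0r_neq0.
by rewrite sqr_sqrtr//; field; exact: lt0r_neq0.
Qed.

(** * The real spectral theorem *)

Lemma norm_sq (R : realType) (n : nat) (v : 'cV[R]_n) :
  norm2 v ^+ 2 = (v^T *m v) 0 0.
Proof.
rewrite sqr_sqrtr ?sumr_ge0// => [|i _]; last exact: sqr_ge0.
by rewrite mxE; apply: eq_bigr => i _; rewrite mxE -expr2.
Qed.

Lemma norm2_eq0 (R : realType) (n : nat) (v : 'cV[R]_n) :
  (norm2 v == 0) = (v == 0).
Proof.
apply/idP/idP => [|/eqP ->]; last first.
  by rewrite /norm2 big1 ?sqrtr0// => i _; rewrite mxE expr0n.
rewrite sqrtr_eq0 => s0; apply/eqP/colP => i; rewrite mxE.
have sq0 j : true -> 0 <= v j 0 ^+ 2 by move=> _; exact: sqr_ge0.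
have /(psumr_eq0P sq0)/(_ i isT)/eqP : \sum_i v i 0 ^+ 2 = 0.
  by apply/eqP; rewrite eq_le s0 sumr_ge0// => j _; exact: sqr_ge0.
by rewrite sqrf_eq0 => /eqP.
Qed.

(** Over the complex numbers the matrix is Hermitian, so any of its spectral
    values is real, and eigenvalues descend along a field embedding. *)
Lemma symmetric_real_eigenvalue (R : rcfType) (n : nat) (S : 'M[R]_n.+1) :
  S^T = S -> exists a, eigenvalue S a.
Proof.
move=> St; pose f : {rmorphism R -> R[i]} := real_complex R; pose SC := map_mx f S.
have SCsym : SC \is symmetricmx.
  by apply/is_hermitianmxP; rewrite expr0 scale1r map_mx_id// map_trmx St.
have SCreal : SC \is a realmx.
  by apply/mxOverP => i j; rewrite !mxE; apply/complex_realP; exists (S i j).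
have SCherm := realsym_hermsym SCsym SCreal.
have /orthomx_spectralP := hermitian_normalmx SCherm.
have := hermitian_spectral_diag_real SCherm.
have := spectral_unit SC.
move: (spectralmx SC) (spectral_diag SC) => P D Pu /mxOverP/(_ 0 0).
move=> /complex_realP[a aE] SCE.
exists a; rewrite -(eigenvalue_map f) -/SC SCE.
apply/eigenvalueP; exists (row 0 P).
  rewrite !mulmxA -row_mul mulmxV// row1 -rowE row_diag_mx -scalemxAl -rowE.
  by rewrite aE.
apply: contraTneq Pu => row0; rewrite unitmxE unitfE negbK.
rewrite (expand_det_row _ 0) big1// => j _.
by have /rowP/(_ j) := row0; rewrite !mxE => ->; rewrite mul0r.
Qed.

(** The reflection exchanging the first basis vector [e] and [u]. *)
Lemma householder (R : realType) (n : nat) (u : 'cV[R]_n.+1) :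
  norm2 u = 1 -> exists H : 'M[R]_n.+1, [/\ H^T = H, H *m H = 1%:M & col 0 H = u].
Proof.
move=> u1; pose e : 'cV[R]_n.+1 := delta_mx 0 0; pose v := u - e.
have [/eqP|v0] := eqVneq v 0.
  rewrite subr_eq0 => /eqP ->; exists 1%:M; split; first exact: trmx1.
    exact: mul1mx.
  by apply/colP => i; rewrite !mxE andbT.
pose q := (v^T *m v) 0 0.
have q0 : q != 0 by rewrite /q -norm_sq sqrf_eq0 norm2_eq0.
have qE : v^T *m v = q%:M by exact: mx11_scalar.
have qu : q = 2 - 2 * u 0 0.
  rewrite /q /v [(_ - _)^T]linearB/= mulmxBl !mulmxBr.
  have -> : u^T *m u = 1%:M by rewrite [LHS]mx11_scalar -norm_sq u1 expr1n.
  rewrite /e trmx_delta -rowE -colE -rowE !mxE !eqxx/= mulr1n; ring.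
pose c := 2 / q.
have vvE : v *m v^T *m (v *m v^T) = q *: (v *m v^T).
  by rewrite mulmxA -[v *m v^T *m v]mulmxA qE mul_mx_scalar -scalemxAl.
exists (1%:M - c *: (v *m v^T)); split.
- by rewrite linearB/= trmx1 linearZ/= trmx_mul trmxK.
- rewrite mulmxBl !mulmxBr !mul1mx mulmx1 -scalemxAl -scalemxAr.
  rewrite vvE !scalerA (_ : c * c * q = c + c); last by rewrite /c; field.
  by rewrite scalerDl opprB addrK subrK.
- rewrite colE mulmxBl mul1mx -scalemxAl -mulmxA -/e.
  have -> : v^T *m e = (u 0 0 - 1)%:M.
    by rewrite /e -colE [LHS]mx11_scalar !mxE.
  have cu : c * (u 0 0 - 1) = -1.
    by move: q0; rewrite /c qu => q0; field.
  by rewrite mul_mx_scalar scalerA cu scaleN1r opprK /v addrC subrK.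
Qed.

Lemma sum_outer_diag (R : comPzRingType) (n : nat) (f : 'I_n -> R) (U : 'M[R]_n) :
  \sum_i f i *: (col i U *m (col i U)^T) = U *m diag_mx (\row_i f i) *m U^T.
Proof.
apply/matrixP => i j; rewrite summxE mul_mx_diag mxE; apply: eq_bigr => m _.
by rewrite !mxE big_ord1 !mxE mulrA [f m * _]mulrC.
Qed.

(** Deflation: conjugating by a reflection that sends the first basis vector to
    a unit eigenvector leaves a block diagonal matrix with a smaller symmetric
    block. *)
Lemma spectral_theorem (R : realType) (n : nat) (S : 'M[R]_n) :
  S^T = S -> exists mu U, eigendecomposition S mu U.
Proof.
elim: n S => [|n IHn] S St.
  by exists (fun=> 0), 1%:M; split; apply/matrixP => -[].
have [a /eigenvalueP[r rE r0]] := symmetric_real_eigenvalue St.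
have nr0 : norm2 r^T != 0 by rewrite norm2_eq0 trmx_eq0.
pose u := (norm2 r^T)^-1 *: r^T.
have u1 : norm2 u = 1.
  have u0 : 0 <= norm2 u by exact: sqrtr_ge0.
  apply/eqP; rewrite -(@eqrXn2 _ 2)// expr1n; apply/eqP.
  rewrite norm_sq /u [(_ *: _)^T]linearZ/= -scalemxAl -scalemxAr scalerA mxE.
  by rewrite -norm_sq -expr2 exprVn mulVf// expf_neq0.
have Su : S *m u = a *: u.
  by rewrite /u -scalemxAr -[S]St -trmx_mul rE linearZ/= !scalerA mulrC.
have [H [Ht HH H0]] := householder u1.
move EB : (H *m S *m H) => B.
have Bt : B^T = B by rewrite -EB !trmx_mul Ht St mulmxA.
have B0 : B *m delta_mx 0 0 = a *: delta_mx (0 : 'I_n.+1) (0 : 'I_1).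
  rewrite -EB -mulmxA -colE H0 -mulmxA Su -scalemxAr -H0 colE mulmxA HH.
  by rewrite mul1mx.
have Bi0 (i j : 'I_n.+1) : j = 0%N :> nat -> B i j = a * (i == 0%N :> nat)%:R.
  move=> j0; have -> : j = 0 by exact: val_inj.
  by have /colP/(_ i) := B0; rewrite -colE !mxE andbT.
pose B' := drsubmx (B : 'M[R]_(1 + n)).
have BE : (B : 'M[R]_(1 + n)) = block_mx a%:M 0 0 B'.
  apply: etrans (esym (@submxK _ 1 n 1 n B)) _; congr block_mx;
    apply/matrixP => i j; rewrite !mxE.
  - by rewrite !ord1; apply: etrans (Bi0 _ _ _) _; rewrite //= mulr1 mulr1n.
  - rewrite -[B]Bt mxE; apply: etrans (Bi0 _ _ _) _; first by rewrite ord1.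
    by rewrite /= mulr0.
  - apply: etrans (Bi0 _ _ _) _; first by rewrite ord1.
    by rewrite /= mulr0.
have [|mu [U [UU B'E]]] := IHn B'; first by rewrite /B' trmx_drsub Bt.
pose V : 'M[R]_(1 + n) := block_mx 1%:M 0 0 U.
pose nu (i : 'I_(1 + n)) := 
  match fintype.split i with inl _ => a | inr j => mu j end.
have Vt : V^T = block_mx 1%:M 0 0 U^T by rewrite /V tr_block_mx !trmx0 trmx1.
have VV : V^T *m V = 1%:M.
  rewrite Vt /V mulmx_block UU !(mulmx0, mul0mx, addr0, add0r) mul1mx.
  by rewrite -scalar_mx_block.
have nuE : diag_mx (\row_i nu i) = block_mx a%:M 0 0 (diag_mx (\row_i mu i)).
  have -> : \row_i nu i = row_mx (const_mx a) (\row_i mu i).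
    by apply/rowP => i; rewrite !mxE /nu; case: fintype.splitP => j _; rewrite !mxE.
  by rewrite diag_mx_row diag_const_mx.
have BV : V *m diag_mx (\row_i nu i) *m V^T = B.
  rewrite nuE BE Vt /V !mulmx_block.
  rewrite !(mulmx0, mul0mx, addr0, add0r, mul1mx, mulmx1).
  by rewrite B'E sum_outer_diag.
have HVt : (H *m V)^T = V^T *m H by rewrite trmx_mul Ht.
exists nu, (H *m V); split.
  by rewrite HVt -mulmxA (mulmxA H H) HH mul1mx; exact: VV.
rewrite sum_outer_diag HVt.
have -> : H *m V *m diag_mx (\row_i nu i) *m (V^T *m H) =
    H *m (V *m diag_mx (\row_i nu i) *m V^T) *m H by rewrite !mulmxA.
by rewrite BV -EB !mulmxA HH mul1mx -mulmxA HH mulmx1.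
Qed.

(** * Polynomials of a matrix in an eigenbasis and in a Krylov basis *)

(** The vector [q(M) v], as a combination of vectors so that dimension zero is
    covered: the Krylov space of [b = 0] is trivial. *)
Definition poly_action (R : nzRingType) (n : nat) (M : 'M[R]_n) (q : {poly R})
    (v : 'cV[R]_n) : 'cV[R]_n :=
  \sum_(i < size q) q`_i *: (M ^+ i *m v).

Lemma mulmx_poly_action (R : comNzRingType) (m n : nat) (X : 'M[R]_(m, n))
    (M : 'M[R]_n) (q : {poly R}) (v : 'cV[R]_n) :
  X *m poly_action M q v = \sum_(i < size q) q`_i *: (X *m (M ^+ i *m v)).
Proof. by rewrite mulmx_sumr; apply: eq_bigr => i _; rewrite -scalemxAr. Qed.

Section EigenCoordinates.
Variables (R : realType) (n : nat) (M : 'M[R]_n) (mu : 'I_n -> R) (U : 'M[R]_n).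
Hypothesis dM : eigendecomposition M mu U.

Lemma eigenbasisK (v : 'cV[R]_n) : U *m (U^T *m v) = v.
Proof. by rewrite mulmxA (mulmx1C dM.1) mul1mx. Qed.

Lemma eigen_coord_sum (f : R -> R) (v : 'cV[R]_n) j :
  (U^T *m ((\sum_(i < n) f (mu i) *: (col i U *m (col i U)^T)) *m v)) j 0 =
  f (mu j) * (U^T *m v) j 0.
Proof.
rewrite (sum_outer_diag (f \o mu)) !mulmxA dM.1 mul1mx -mulmxA.
by rewrite mul_diag_mx !mxE.
Qed.

Lemma eigen_coordM (v : 'cV[R]_n) j :
  (U^T *m (M *m v)) j 0 = mu j * (U^T *m v) j 0.
Proof. by rewrite [in LHS]dM.2 (eigen_coord_sum id). Qed.

Lemma eigen_coordX i (v : 'cV[R]_n) j :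
  (U^T *m (M ^+ i *m v)) j 0 = mu j ^+ i * (U^T *m v) j 0.
Proof.
elim: i => [|i IHi]; first by rewrite !expr0 mul1mx mul1r.
by rewrite exprS -mulmxA eigen_coordM IHi exprS mulrA.
Qed.

Lemma eigen_coord_poly q (v : 'cV[R]_n) j :
  (U^T *m poly_action M q v) j 0 = q.[mu j] * (U^T *m v) j 0.
Proof.
rewrite mulmx_poly_action summxE horner_coef mulr_suml.
by apply: eq_bigr => i _; rewrite mxE eigen_coordX mulrA.
Qed.

Lemma eigen_coord_inj (v w : 'cV[R]_n) :
  (forall j, (U^T *m v) j 0 = (U^T *m w) j 0) -> v = w.
Proof.
by move=> vw; rewrite -[v]eigenbasisK -[w]eigenbasisK; congr (_ *m _); apply/colP.
Qed.

Lemma dot_eigen (v w : 'cV[R]_n) :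
  (v^T *m w) 0 0 = \sum_j (U^T *m v) j 0 * (U^T *m w) j 0.
Proof.
rewrite -{1}[v]eigenbasisK -{1}[w]eigenbasisK trmx_mul -mulmxA.
rewrite [U^T *m (U *m _)]mulmxA dM.1 mul1mx mxE.
by apply: eq_bigr => j _; rewrite [(U^T *m v)^T _ _]mxE.
Qed.

Lemma norm_sq_eigen (v : 'cV[R]_n) :
  norm2 v ^+ 2 = \sum_j (U^T *m v) j 0 ^+ 2.
Proof. by rewrite norm_sq dot_eigen; apply: eq_bigr => j _; rewrite expr2. Qed.

Lemma rayleigh_le (L : R) (v : 'cV[R]_n) : (forall j, mu j <= L) ->
  (v^T *m M *m v) 0 0 <= L * norm2 v ^+ 2.
Proof.
move=> muL; rewrite -mulmxA dot_eigen norm_sq_eigen mulr_sumr.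
apply: ler_sum => j _; rewrite eigen_coordM mulrCA -expr2.
by rewrite ler_wpM2r// sqr_ge0.
Qed.

Lemma eigenvectorE j : M *m col j U = mu j *: col j U.
Proof.
apply: eigen_coord_inj => i; rewrite eigen_coordM -scalemxAr [RHS]mxE.
rewrite colE [U^T *m _]mulmxA dM.1 mul1mx !mxE.
by case: eqVneq => [->|]//; rewrite !mulr0.
Qed.

Lemma norm_eigenvector j : norm2 (col j U) ^+ 2 = 1.
Proof.
rewrite norm_sq; transitivity ((U^T *m U) j j); last by rewrite dM.1 mxE eqxx.
by rewrite !mxE; apply: eq_bigr => i _; rewrite !mxE.
Qed.

Lemma eigenvalue_rayleigh j : mu j = ((col j U)^T *m M *m col j U) 0 0.
Proof.
by rewrite -mulmxA eigenvectorE -scalemxAr mxE -norm_sq norm_eigenvector mulr1.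
Qed.

End EigenCoordinates.

(** The eigendecomposition is the one that [matfun] chose. *)
Lemma matfun_eigen (R : realType) (n : nat) (f : R -> R) (M : 'M[R]_n) :
  M^T = M -> exists mu U, eigendecomposition M mu U /\
    forall (v : 'cV[R]_n) j,
      (U^T *m (matfun f M *m v)) j 0 = f (mu j) * (U^T *m v) j 0.
Proof.
move=> Mt; rewrite /matfun; case: xgetP => [N _ [mu [U [dM ->]]]|].
  by exists mu, U; split => // v j; rewrite (eigen_coord_sum dM f).
have [mu [U dM]] := spectral_theorem Mt.
by move=> /(_ (\sum_(i < n) f (mu i) *: (col i U *m (col i U)^T)))[]; exists mu, U.
Qed.

Lemma posdef_eigenvalue_gt0 (R : realType) (n : nat) (A : 'M[R]_n) mu U j :
  posdefmx A -> eigendecomposition A mu U -> 0 < mu j.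
Proof.
move=> [_ Apos] dA; rewrite (eigenvalue_rayleigh dA); apply: Apos.
by rewrite -norm2_eq0 -sqrf_eq0 (norm_eigenvector dA) oner_eq0.
Qed.

Section Projection.
Variables (R : realType) (d m k : nat) (A : 'M[R]_d) (b : 'cV[R]_d).
Variable Q : 'M[R]_(d, m).
Hypothesis QQ : Q^T *m Q = 1%:M.
Hypothesis Qspan : forall i, (i < k)%N -> Q *m (Q^T *m (A ^+ i *m b)) = A ^+ i *m b.
Let T := Q^T *m A *m Q.

(** [Q Q^T] fixes the Krylov vectors, so it can be inserted after each
    application of [A]. *)
Lemma krylov_power i : (i < k)%N -> A ^+ i *m b = Q *m (T ^+ i *m (Q^T *m b)).
Proof.
elim: i => [|i IHi] ik.
  by rewrite -(Qspan ik) !expr0 !mul1mx.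
rewrite -(Qspan ik); congr (_ *m _).
by rewrite exprS -mulmxA (IHi (ltnW ik)) exprS -!mulmxA.
Qed.

(** The range of exponents is one longer than in [krylov_power]: the last
    application of [A] is followed by [Q^T], so no projection is needed after
    it. This extra degree gives the orthogonality of the residual. *)
Lemma krylov_powerT i : (i <= k)%N ->
  Q^T *m (A ^+ i *m b) = T ^+ i *m (Q^T *m b).
Proof.
case: i => [|i] ik; first by rewrite !expr0 !mul1mx.
by rewrite exprS -mulmxA (krylov_power ik) exprS -!mulmxA.
Qed.

Lemma krylov_poly (q : {poly R}) : (size q <= k)%N ->
  poly_action A q b = Q *m poly_action T q (Q^T *m b).
Proof.
move=> qk; rewrite mulmx_poly_action; apply: eq_bigr => i _.
by rewrite krylov_power// (leq_trans _ qk).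
Qed.

Lemma krylov_polyT (q : {poly R}) : (size q <= k.+1)%N ->
  Q^T *m poly_action A q b = poly_action T q (Q^T *m b).
Proof.
move=> qk; rewrite mulmx_poly_action; apply: eq_bigr => i _.
by rewrite krylov_powerT// -ltnS (leq_trans _ qk).
Qed.

End Projection.

(** * The error of a projection onto a Krylov space *)

Lemma eigendecomposition_eigenvalue (R : realType) (n : nat) (A : 'M[R]_n) mu U j :
  A^T = A -> eigendecomposition A mu U -> eigenvalue A (mu j).
Proof.
move=> At dA; apply/eigenvalueP; exists (col j U)^T.
  by rewrite -[A]At -trmx_mul (eigenvectorE dA) linearZ.
by rewrite trmx_eq0 -norm2_eq0 -sqrf_eq0 (norm_eigenvector dA) oner_eq0.
Qed.

(** An eigenvalue of the compression is a Rayleigh quotient of [A] at the unit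
    vector [Q w]. *)
Lemma ritz_values_bounded (R : realType) (d m : nat) (A : 'M[R]_d)
    (Q : 'M[R]_(d, m)) (L : R) theta W j :
  posdefmx A -> (forall x, eigenvalue A x -> x <= L) -> Q^T *m Q = 1%:M ->
  eigendecomposition (Q^T *m A *m Q) theta W -> 0 < theta j <= L.
Proof.
move=> Apos AL QQ dT; rewrite (eigenvalue_rayleigh dT).
pose y := Q *m col j W.
have -> : (col j W)^T *m (Q^T *m A *m Q) *m col j W = y^T *m A *m y.
  by rewrite /y trmx_mul !mulmxA.
have y1 : norm2 y ^+ 2 = 1.
  rewrite norm_sq trmx_mul -mulmxA [Q^T *m _]mulmxA QQ mul1mx -norm_sq.
  exact: norm_eigenvector dT j.
have [mu [U dA]] := spectral_theorem Apos.1.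
apply/andP; split.
  by apply: Apos.2; rewrite -norm2_eq0 -sqrf_eq0 y1 oner_eq0.
rewrite -[leRHS]mulr1 -y1; apply: (rayleigh_le dA) => i.
exact/AL/(eigendecomposition_eigenvalue i Apos.1 dA).
Qed.

(** The distinct eigenvalues of the compression serve as nodes. If there are
    fewer than [k] of them, their nodal polynomial [F] has degree less than [k]
    and kills the compression, so [F(A) b = 0]: every eigenvalue that matters is
    a node and the error vanishes. Otherwise [F(A) b] is orthogonal to the range
    of [Q], and the scalar estimate applies. *)
Lemma projection_sqrt_error (R : realType) (d m k : nat) (A : 'M[R]_d)
    (b : 'cV[R]_d) (Q : 'M[R]_(d, m)) (l L M : R) (P : {poly R}) :
  posdefmx A -> (0 < k)%N -> (m <= k)%N -> Q^T *m Q = 1%:M ->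
  (forall i, (i < k)%N -> Q *m (Q^T *m (A ^+ i *m b)) = A ^+ i *m b) ->
  0 < l -> 0 <= L -> 0 <= M -> (forall x, eigenvalue A x -> l <= x <= L) ->
  (size P <= k.+1)%N -> P.[0] = 1 ->
  (forall x, eigenvalue A x -> `|P.[x]| <= M) ->
  norm2 (matfun Num.sqrt A *m b -
         Q *m (matfun Num.sqrt (Q^T *m A *m Q) *m (Q^T *m b))) <=
    sqrt_coef R k * (L * Num.sqrt L) / l * M * norm2 b.
Proof.
move=> Apos k0 mk QQ Qspan l0 L0 M0 AlL szP P0 PM.
set T := Q^T *m A *m Q.
have Tt : T^T = T by rewrite /T !trmx_mul trmxK Apos.1 mulmxA.
have [mu [U [dA sqrtA]]] := matfun_eigen Num.sqrt Apos.1.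
have [th [W [dT sqrtT]]] := matfun_eigen Num.sqrt Tt.
have muA j := eigendecomposition_eigenvalue j Apos.1 dA.
pose ths := undup (codom th).
have uths : uniq ths := undup_uniq _.
have thsE j : th j \in ths by rewrite mem_undup codom_f.
have thsB : {in ths, forall x, 0 < x <= L}.
  move=> x; rewrite mem_undup => /codomP[j ->].
  by apply: (ritz_values_bounded (W := W) j Apos _ QQ) => // y /AlL /andP[].
have szths : (size ths <= k)%N.
  by rewrite (leq_trans (size_undup _))// size_codom card_ord.
have [p szp pE] := interpolation_exists Num.sqrt uths.
pose F := \prod_(x <- ths) ('X - x%:P).
have F0 x : x \in ths -> F.[x] = 0 by rewrite -root_prod_XsubC => /eqP.
have szF : size F = (size ths).+1 by rewrite size_prod_XsubC.
have lanE : Q *m (matfun Num.sqrt T *m (Q^T *m b)) = poly_action A p b.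
  rewrite (krylov_poly Qspan) ?(leq_trans szp)//; congr (_ *m _).
  by apply: (eigen_coord_inj dT) => j; rewrite sqrtT (eigen_coord_poly dT) pE.
rewrite lanE; set e := _ - _; pose be j := (U^T *m b) j 0.
have eE j : (U^T *m e) j 0 = (Num.sqrt (mu j) - p.[mu j]) * be j.
  by rewrite mulmxBr mxE [X in _ + X]mxE sqrtA (eigen_coord_poly dA) mulrBl.
have FT0 : poly_action T F (Q^T *m b) = 0.
  apply: (eigen_coord_inj dT) => j.
  by rewrite (eigen_coord_poly dT) F0// mul0r mulmx0 mxE.
have C0 : 0 <= sqrt_coef R k * (L * Num.sqrt L) / l * M.
  rewrite mulr_ge0// divr_ge0 ?(ltW l0)// mulr_ge0 ?sqrt_coef_ge0//.
  by rewrite mulr_ge0// sqrtr_ge0.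
have [szk|szk] := ltnP (size ths) k.
  have FA0 : poly_action A F b = 0.
    by rewrite (krylov_poly Qspan) ?szF// FT0 mulmx0.
  suff -> : e = 0 by rewrite (eqP (_ : norm2 0 == 0)) ?norm2_eq0//
    mulr_ge0// sqrtr_ge0.
  (* A coordinate of [b] can be nonzero only where [F] vanishes. *)
  apply: (eigen_coord_inj dA) => j; rewrite mulmx0 [RHS]mxE eE.
  have := eigen_coord_poly dA F b j; rewrite FA0 mulmx0 mxE -/(be j).
  move=> /esym/eqP; rewrite mulf_eq0 => /orP[|/eqP ->]; last by rewrite mulr0.
  by rewrite -[_ == 0]/(root F (mu j)) root_prod_XsubC => /pE ->; rewrite subrr mul0r.
have {}szk : size ths = k by apply/eqP; rewrite eqn_leq szths.
rewrite -(@ler_pXn2r _ 2)// ?nnegrE; last 2 first.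
- exact: sqrtr_ge0.
- by rewrite mulr_ge0// sqrtr_ge0.
rewrite exprMn (norm_sq_eigen dA e) (norm_sq_eigen dA b).
rewrite (eq_bigr (fun j => be j ^+ 2 * (Num.sqrt (mu j) - p.[mu j]) ^+ 2)); last first.
  by move=> j _; rewrite eE exprMn mulrC.
apply: (@weighted_sqrt_error _ _ _ mu (fun j => be j ^+ 2) l L M ths p P) => //.
- by move=> j; exact: AlL.
- by move=> j; exact: sqr_ge0.
- by rewrite -szk.
- move=> s szs.
  transitivity (((poly_action A s b)^T *m poly_action A F b) 0 0).
    rewrite (dot_eigen dA); apply: eq_bigr => j _.
    by rewrite !(eigen_coord_poly dA) -/(be j); ring.
  rewrite (krylov_poly Qspan szs) trmx_mul.
  rewrite -[_ *m poly_action A F b]mulmxA (krylov_polyT Qspan).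
    by rewrite FT0 mulmx0 mxE.
  by rewrite szF szk.
- by move=> j; exact: PM.
Qed.

(** * Gram-Schmidt *)

Section GramSchmidt.
Variables (R : realType) (d : nat).
Implicit Types (v w : 'cV[R]_d) (qs : seq 'cV[R]_d).

Let dot v w := (v^T *m w) 0 0.
Let proj qs v := \sum_(q <- qs) dot q v *: q.

Definition orthonormal_seq qs := forall i j, (i < size qs)%N -> (j < size qs)%N ->
  ((qs`_i)^T *m qs`_j) 0 0 = (i == j)%:R.

Let dotC v w : dot v w = dot w v.
Proof. by rewrite /dot -[v in RHS]trmxK -trmx_mul [RHS]mxE. Qed.

Let dotZr a v w : dot v (a *: w) = a * dot v w.
Proof. by rewrite /dot -scalemxAr mxE. Qed.

Let dotDr v w1 w2 : dot v (w1 + w2) = dot v w1 + dot v w2.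
Proof. by rewrite /dot mulmxDr mxE. Qed.

Let dot_proj qs v w : dot w (proj qs v) = \sum_(q <- qs) dot q v * dot w q.
Proof.
rewrite /dot mulmx_sumr summxE; apply: eq_bigr => q _.
by rewrite -scalemxAr mxE.
Qed.

Let residual_orth qs v j : orthonormal_seq qs -> (j < size qs)%N ->
  dot qs`_j (v - proj qs v) = 0.
Proof.
move=> oqs jqs; rewrite dotDr -scaleN1r dotZr dot_proj (big_nth 0) big_mkord.
rewrite (bigD1 (Ordinal jqs))//= big1 => [|i ij].
  by rewrite [dot qs`_j qs`_j]oqs// eqxx mulr1 addr0 mulN1r subrr.
rewrite [dot qs`_j _]oqs// -[j]/(val (Ordinal jqs)) val_eqE eq_sym.
by rewrite (negbTE ij) mulr0.
Qed.

Let gram_schmidt_stepP qs v (w := v - proj qs v) :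
  gram_schmidt_step qs v = if w == 0 then qs else rcons qs ((norm2 w)^-1 *: w).
Proof. by []. Qed.

Let gram_schmidt_step_orthonormal qs v :
  orthonormal_seq qs -> orthonormal_seq (gram_schmidt_step qs v).
Proof.
move=> oqs; rewrite gram_schmidt_stepP; set w := _ - _.
case: ifPn => // w0; pose q := (norm2 w)^-1 *: w.
have oq j : (j < size qs)%N -> dot qs`_j q = 0.
  by move=> jqs; rewrite dotZr residual_orth// mulr0.
have q1 : dot q q = 1.
  rewrite dotZr dotC dotZr [dot w w](_ : _ = norm2 w ^+ 2); last by rewrite norm_sq.
  by field; rewrite norm2_eq0.
move=> i j; rewrite size_rcons !ltnS !nth_rcons.
rewrite [(i <= _)%N]leq_eqVlt [(j <= _)%N]leq_eqVlt.
move=> /predU1P[->|iqs] /predU1P[->|jqs].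
- by rewrite ltnn !eqxx; exact: q1.
- rewrite ltnn eqxx jqs gtn_eqF//; apply: etrans (dotC _ _) _; exact: oq.
- rewrite ltnn eqxx iqs ltn_eqF//; exact: oq.
- by rewrite iqs jqs; exact: oqs.
Qed.

Let gram_schmidt_step_fix qs u v : orthonormal_seq qs ->
  proj qs v = v -> proj (gram_schmidt_step qs u) v = v.
Proof.
move=> oqs pv; rewrite gram_schmidt_stepP; set w := _ - _.
case: ifPn => // w0; rewrite /proj -cats1 big_cat/= big_seq1 -/(proj qs v) pv.
rewrite dotC dotZr -[v in dot v w]pv dotC dot_proj (big_nth 0) big_mkord big1.
  by rewrite mulr0 scale0r addr0.
by move=> i _; rewrite [dot w _]dotC residual_orth// mulr0.
Qed.

Let gram_schmidt_step_span qs v : orthonormal_seq qs ->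
  proj (gram_schmidt_step qs v) v = v.
Proof.
move=> oqs; rewrite gram_schmidt_stepP; set w := _ - _.
case: ifPn => [|w0]; first by rewrite subr_eq0 => /eqP.
rewrite /proj -cats1 big_cat/= big_seq1 -/(proj qs v).
have vE : v = w + proj qs v by rewrite subrK.
have wv : dot w v = norm2 w ^+ 2.
  rewrite vE dotDr dot_proj (big_nth 0) big_mkord big1 ?addr0 ?norm_sq//.
  by move=> i _; rewrite [dot w _]dotC residual_orth// mulr0.
rewrite dotC dotZr dotC wv scalerA expr2 mulKf ?norm2_eq0// mulfV ?norm2_eq0//.
by rewrite scale1r addrC -vE.
Qed.

(** That every input lies in the span of the output is expressed by the
    expansion of the input on the output, since this is the identity
    [Q Q^T v = v] in matrix form. *)
Lemma gram_schmidt_spec (vs : seq 'cV[R]_d) (qs := gram_schmidt vs) :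
  [/\ orthonormal_seq qs, (size qs <= size vs)%N &
     {in vs, forall v, \sum_(q <- qs) (q^T *m v) 0 0 *: q = v}].
Proof.
rewrite {}/qs; elim/last_ind: vs => [|vs v [oqs szqs IHvs]]; first by split.
rewrite /gram_schmidt foldl_rcons -/(gram_schmidt vs); split.
- exact: gram_schmidt_step_orthonormal.
- rewrite gram_schmidt_stepP size_rcons; case: ifP => _; last by rewrite size_rcons.
  exact: leqW.
- move=> u; rewrite mem_rcons inE => /predU1P[->|uvs].
    exact: gram_schmidt_step_span.
  by apply: gram_schmidt_step_fix => //; exact: IHvs.
Qed.

End GramSchmidt.

Lemma lanczosQ_spec (R : realType) (d k : nat) (A : 'M[R]_d) (b : 'cV[R]_d)
    (Q := lanczosQ A b k) :
  [/\ (size (lanczos_basis A b k) <= k)%N, Q^T *m Q = 1%:M &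
    forall i, (i < k)%N -> Q *m (Q^T *m (A ^+ i *m b)) = A ^+ i *m b].
Proof.
have [oqs szqs spanqs] := gram_schmidt_spec (krylov_seq A b k).
rewrite -/(lanczos_basis A b k) in oqs szqs spanqs.
have colQ j : col j Q = (lanczos_basis A b k)`_j.
  by apply/colP => i; rewrite !mxE.
split.
- by rewrite (leq_trans szqs)// size_map size_iota.
- apply/matrixP => i j; rewrite !mxE -(oqs i j)// -!colQ !mxE.
  by apply: eq_bigr => r _; rewrite !mxE.
- move=> i ik; have /spanqs {2}<- : A ^+ i *m b \in krylov_seq A b k.
    by apply/mapP; exists i; rewrite // mem_iota.
  move: (A ^+ i *m b) => v.
  rewrite (big_nth 0) big_mkord; apply/colP => r.
  rewrite mxE summxE; apply: eq_bigr => j _.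
  rewrite [RHS]mxE mulrC -colQ; congr (_ * _); last by rewrite !mxE.
  by rewrite tr_col -row_mul [row _ _ _ _]mxE.
Qed.

(** * Best polynomial approximation on a finite set *)

Lemma approx_error_bigmax (R : realType) (s : seq R) (f : R -> R) (p : {poly R}) :
  s != [::] ->
  approx_error [set` s] f p = \big[Num.max/0]_(x <- s) `|f x - p.[x]|.
Proof.
case: s => // x0 s _; set t := x0 :: s.
have ub : ubound [set `|f x - p.[x]| | x in [set` t]]
    (\big[Num.max/0]_(x <- t) `|f x - p.[x]|).
  move=> _ [x xt <-].
  exact: (@le_bigmax_seq _ _ _ t 0 x xpredT (fun x => `|f x - p.[x]|)).
have im x : x \in t -> [set `|f x - p.[x]| | x in [set` t]] `|f x - p.[x]|.
  by move=> xt; exists x.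
apply/le_anti/andP; split.
  by apply: ge_sup => //; exists `|f x0 - p.[x0]|; apply: im; exact: mem_head.
rewrite big_seq; apply: bigmax_le => [|x xt].
  apply: le_trans (ub_le_sup (ex_intro _ _ ub) (im x0 (mem_head _ _))).
  exact: normr_ge0.
exact: ub_le_sup (ex_intro _ _ ub) _ (im x xt).
Qed.

Lemma continuous_bigmax_norm (R : realType) (T : topologicalType) (I : Type)
    (s : seq I) (g : I -> T -> R^o) :
  (forall i, continuous (g i)) ->
  continuous (fun v : T => \big[Num.max/0]_(i <- s) `|g i v| : R^o).
Proof.
move=> gc; elim: s => [|i s IHs] v.
  under eq_fun do rewrite big_nil.
  exact: cvg_cst.
under eq_fun do rewrite big_cons.
apply: (@continuous_max R T (fun v => `|g i v|)); last exact: IHs.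
by apply: cvg_norm; exact: gc.
Qed.

Lemma continuous_affine (R : realType) (T : topologicalType) (n : nat)
    (c : R) (g : 'I_n -> T -> R^o) (a : 'I_n -> R) :
  (forall i, continuous (g i)) ->
  continuous (fun v : T => c - \sum_i g i v * a i : R^o).
Proof.
move=> gc v; apply: cvgB; first exact: cvg_cst.
elim: (index_enum _) => [|i r IHr].
  by under eq_fun do rewrite big_nil; rewrite big_nil; exact: cvg_cst.
under eq_fun do rewrite big_cons; rewrite big_cons.
by apply: cvgD => //; apply: cvgM; [exact: gc|exact: cvg_cst].
Qed.

(** A polynomial is parametrised by its values at [n] distinct points [t] of
    [s]. With [n] the smaller of [D] and the number of points of [s], the
    interpolant of these values agrees on [s] with the polynomial. A competitor
    at least as good as [0] has these values in a box, which is compact, and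
    the error is continuous in them. *)
Lemma best_approximation_exists (R : realType) (s : seq R) (f : R -> R) (D : nat) :
  s != [::] -> exists m, is_min [set approx_error [set` s] f p
    | p in [set p : {poly R} | (size p <= D)%N]] m.
Proof.
move=> s0; pose t := take D (undup s); pose n := size t.
have tu : uniq t by rewrite take_uniq// undup_uniq.
have ts x : x \in t -> x \in s by move=> /mem_take; rewrite mem_undup.
have nD : (n <= D)%N by rewrite /n size_take_min geq_minl.
(* The Lagrange basis at the points [t]. *)
have /choice[ell ellP] : forall i : 'I_n, exists q : {poly R}, (size q <= n)%N /\
    {in t, forall x, q.[x] = (x == t`_i)%:R}.
  move=> i; have [q szq qE] := interpolation_exists (fun x => (x == t`_i)%:R) tu.
  by exists q.
pose P (v : 'rV[R]_n) := \sum_i v 0 i *: ell i.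
have szP v : (size (P v) <= D)%N.
  rewrite (leq_trans _ nD)// (leq_trans (size_sum _ _ _))//.
  apply/bigmax_leqP => i _; rewrite (leq_trans (size_scale_leq _ _))//.
  exact: (ellP i).1.
have Pt v (i : 'I_n) : (P v).[t`_i] = v 0 i.
  rewrite horner_sum (bigD1 i)//= big1 => [|j ji].
    by rewrite hornerZ (ellP i).2 ?mem_nth// eqxx mulr1 addr0.
  rewrite hornerZ (ellP j).2 ?mem_nth// nth_uniq// eq_sym.
  by rewrite val_eqE (negbTE ji) mulr0.
have PE (p : {poly R}) : (size p <= D)%N ->
    {in s, forall x, (P (\row_i p.[t`_i])).[x] = p.[x]}.
  move=> szp x xs; set v := \row_i _.
  have vt y : y \in t -> (P v).[y] = p.[y].
    by move=> /(nthP 0)[i it <-]; rewrite (Pt v (Ordinal it)) mxE.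
  have [tD|Dt] := leqP (size (undup s)) D.
    by rewrite vt// /t take_oversize// mem_undup.
  suff /eqP : P v - p = 0 by rewrite subr_eq0 => /eqP ->.
  apply: (@roots_geq_poly_eq0 _ _ t) => //.
    by apply/allP => y yt; rewrite /root hornerD hornerN vt// subrr.
  rewrite (leq_trans (size_polyD _ _))// size_polyN geq_max.
  by rewrite /t size_takel ?szP ?szp// ltnW.
pose err (p : {poly R}) := \big[Num.max/0]_(x <- s) `|f x - p.[x]|.
have errE (p q : {poly R}) : {in s, forall x, p.[x] = q.[x]} -> err p = err q.
  by move=> pq; apply: eq_big_seq => x xs; rewrite pq.
have le_err p x : x \in s -> `|f x - p.[x]| <= err p.
  move=> xs; exact: (@le_bigmax_seq _ _ _ s 0 x xpredT (fun x => `|f x - p.[x]|)).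
pose B (i : 'I_n) := `[f t`_i - err 0, f t`_i + err 0]%classic.
pose K := [set v : 'rV[R]_n | forall i, B i (v ord0 i)].
have cK : compact K by apply: rV_compact => i; exact: segment_compact.
have K0 : K !=set0.
  exists 0 => i; rewrite /B /= mxE in_itv/=.
  have := le_err 0 t`_i (ts _ (mem_nth 0 (ltn_ord i))).
  by rewrite horner0 subr0 ler_norml; lra.
have cF : {within K, continuous (fun v => err (P v))}.
  apply: continuous_subspaceT.
  apply: (@continuous_bigmax_norm _ _ _ s (fun x v => f x - (P v).[x])) => x.
  rewrite (_ : (fun v => _) =
    fun v : 'rV[R]_n => f x - \sum_i v 0 i * (ell i).[x] :> R^o).
    apply: (@continuous_affine _ _ _ _ (fun i (v : 'rV[R]_n) => v 0 i)) => i.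
    exact: coord_continuous.
  apply/funext => v /=; rewrite horner_sum; congr (_ - _).
  by apply: eq_bigr => i _; rewrite hornerZ.
have [c cK' cmin] := EVT_min_rV K0 cK cF.
exists (err (P c)); split.
  by exists (P c); [exact: szP|rewrite approx_error_bigmax].
move=> _ [p /= szp <-]; rewrite approx_error_bigmax// -/(err p).
have [pB|Bp] := leP (err p) (err 0).
  rewrite -(errE _ _ (PE p szp)); apply: cmin; rewrite inE => i.
  rewrite /B /= mxE in_itv/=.
  have := le_trans (le_err p t`_i (ts _ (mem_nth 0 (ltn_ord i)))) pB.
  by rewrite ler_norml; lra.
apply: le_trans (ltW Bp).
have <- : err (P 0) = err 0.
  by congr err; rewrite /P big1// => i _; rewrite mxE scale0r.
apply: cmin; rewrite inE => i; rewrite /B/= mxE in_itv/=.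
have := le_err 0 t`_i (ts _ (mem_nth 0 (ltn_ord i))).
by rewrite horner0 subr0 ler_norml; lra.
Qed.

(** * The Lanczos iterate *)

Lemma spectrum_codom (R : realType) (n : nat) (A : 'M[R]_n) mu U :
  A^T = A -> eigendecomposition A mu U -> spectrum A = [set` codom mu].
Proof.
move=> At dA; apply/seteqP; split => x /=; last first.
  by move=> /codomP[j ->]; exact: eigendecomposition_eigenvalue dA.
move=> /eigenvalueP[v vA v0]; apply: contraNT v0 => xmu.
rewrite -trmx_eq0; apply/eqP/(eigen_coord_inj dA) => j.
have /(congr1 trmx) := vA; rewrite trmx_mul At linearZ/= => Av.
have := eigen_coordM dA v^T j; rewrite Av -scalemxAr mxE.
rewrite mulmx0 [X in _ -> _ = X]mxE => /eqP; rewrite -subr_eq0 -mulrBl mulf_eq0.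
rewrite subr_eq0 => /orP[/eqP xE|/eqP//].
by rewrite xE codom_f in xmu.
Qed.

Lemma degree_lt_half (R : realType) (n k : nat) :
  (n.-1%:R < k%:R / 2%:R + 1 :> R) = (n <= (k.+1)./2.+1)%N.
Proof.
rewrite -ltrBlDr ltr_pdivlMr// mulrBl mul1r -natrM ltrBlDr -natrD ltr_nat.
have := odd_double_half k.+1; rewrite -mul2n.
by case: (odd k.+1) => /= h; apply/idP/idP; lia.
Qed.

Lemma spectrum_bounds (R : realType) (n : nat) (A : 'M[R]_n.+1) :
  posdefmx A -> 0 < inf (spectrum A) /\
    forall x, eigenvalue A x -> inf (spectrum A) <= x <= sup (spectrum A).
Proof.
move=> Apos; have [mu [U dA]] := spectral_theorem Apos.1.
have specE := spectrum_codom Apos.1 dA.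
have [i _ imin] := @arg_minP _ _ _ (0 : 'I_n.+1) xpredT mu isT.
have [j _ jmax] := @arg_maxP _ _ _ (0 : 'I_n.+1) xpredT mu isT.
have lb : lbound (spectrum A) (mu i).
  by rewrite specE => _ /codomP[r ->]; exact: imin.
have ub : ubound (spectrum A) (mu j).
  by rewrite specE => _ /codomP[r ->]; exact: jmax.
split.
  apply: lt_le_trans (posdef_eigenvalue_gt0 i Apos dA) _; apply: lb_le_inf => //.
  by exists (mu i); exact: eigendecomposition_eigenvalue Apos.1 dA.
move=> x Ax; apply/andP; split; last by apply: ub_le_sup => //; exists (mu j).
by apply: ge_inf => //; exists (mu i).
Qed.

Theorem theorem7 (R : realType) (d : nat) (A : 'M[R]_d) (b : 'cV[R]_d)
    (k : nat) (hA : posdefmx A) (hk : (2 <= k)%N) :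
  exists2 m : R,
    is_min [set approx_error (spectrum A `|` [set 0]) Num.sqrt p
             | p in [set p : {poly R} |
                       (size p).-1%:R < k%:R / 2%:R + 1 :> R]] m
  & norm2 (matfun Num.sqrt A *m b - lan k Num.sqrt A b)
    <= 3%:R * cond A ^+ 2 / (k%:R `^ (3%:R / 2%:R)) * norm2 b * m.
Proof.
have [mu [U dA]] := spectral_theorem hA.1.
have specE := spectrum_codom hA.1 dA.
pose s := 0 :: codom mu.
have sE : spectrum A `|` [set 0] = [set` s].
  rewrite specE; apply/seteqP; split => x /=; rewrite inE.
    by move=> [->|->]; rewrite ?eqxx ?orbT.
  by move=> /predU1P[->|]; [right|left].
have degE : [set p : {poly R} | (size p).-1%:R < k%:R / 2%:R + 1 :> R] =
    [set p : {poly R} | (size p <= (k.+1)./2.+1)%N].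
  by apply/seteqP; split => p /=; rewrite degree_lt_half.
have [m minm] := @best_approximation_exists R s Num.sqrt (k.+1)./2.+1 isT.
exists m; first by rewrite sE degE.
have [[q /= szq qm] _] := minm.
have qS x : x \in s -> `|Num.sqrt x - q.[x]| <= m.
  rewrite -qm approx_error_bigmax// => xs.
  exact: (@le_bigmax_seq _ _ _ s 0 x xpredT (fun x => `|Num.sqrt x - q.[x]|)).
have q0 : `|q.[0]| <= m.
  by have := qS 0 (mem_head _ _); rewrite sqrtr0 sub0r normrN.
have m0 : 0 <= m by exact: le_trans q0.
have qA x : eigenvalue A x -> `|Num.sqrt x - q.[x]| <= m.
  move=> Ax; apply: qS.
  have : spectrum A x by [].
  by rewrite specE /= inE => ->; rewrite orbT.
clear specE s sE minm qm qS.
(* In dimension zero the spectrum is empty and has no meaningful bounds. *)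
case: d A b hA mu U dA qA => [|d] A b hA mu U dA qA.
  rewrite [X in X <= _](_ : _ = 0); last by rewrite /norm2 big_ord0 sqrtr0.
  apply: mulr_ge0 => //; apply: mulr_ge0; last exact: sqrtr_ge0.
  by apply: divr_ge0; [apply: mulr_ge0; [|exact: sqr_ge0]|exact: powR_ge0].
have [l0 AlL] := spectrum_bounds hA.
rewrite /cond; move: (inf _) (sup _) l0 AlL => l L l0 AlL.
have L0 : 0 <= L.
  have /AlL/andP[lx xL] := eigendecomposition_eigenvalue 0 hA.1 dA.
  exact: le_trans (ltW l0) (le_trans lx xL).
have [|x Ax|P [szP P0 PM]] :=
  @residual_of_sqrt_approx R k (spectrum A) l L m q l0 AlL _ q0.
- move: szq (odd_double_half k.+1); rewrite -!mul2n; move: (size q) => c.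
  by move: (k.+1)./2 => h; case: (odd k.+1); rewrite ?add0n; lia.
- exact: qA.
have [basisk QQ Qspan] := lanczosQ_spec k A b.
have M0 : 0 <= 8 * m * Num.sqrt L / l.
  by rewrite divr_ge0 ?(ltW l0)// mulr_ge0 ?sqrtr_ge0// mulr_ge0.
have k0 : (0 < k)%N by exact: leq_trans hk.
rewrite /lan -!mulmxA.
have := projection_sqrt_error hA k0 basisk QQ Qspan l0 L0 M0 AlL szP P0 PM.
move=> /le_trans; apply; exact: sqrt_coef_bound (sqrtr_ge0 _).
Qed.
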